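(* Free left $h$-Ehresmann monoids are left and right ideal Howson; i.e. for every set $X$, the free left $h$-Ehresmann monoid on $X$ is both left ideal Howson and right ideal Howson.
   Context: A semigroup $S$ with a unary operation ${}^+$ is left Ehresmann if $x^+x=x$, $(x^+y^+)^+=x^+y^+=y^+x^+$ and $(xy)^+=(xy^+)^+$ for all $x,y\in S$; it is left $h$-Ehresmann if moreover $(xz^+y)^+=(xy)^+(xz)^+$ for all $x,y,z\in S$. A left $h$-Ehresmann monoid is such a structure with a multiplicative identity, regarded as a $(2,1,0)$-algebra (product, ${}^+$, identity). The free left $h$-Ehresmann monoid on a set $X$ is the (unique up to isomorphism) left $h$-Ehresmann monoid $F$ containing $X$ such that for every left $h$-Ehresmann monoid $M$ every function $X\to M$ extends to a unique $(2,1,0)$-morphism $F\to M$. A monoid $M$ is right ideal Howson if the intersection of any two principal right ideals $aM\cap bM$ is finitely generated as a right ideal (the empty set counts as finitely generated). Left ideal Howson is the dual notion, with principal left ideals $Ma\cap Mb$. *)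

(* Defs.v *)
From HB Require Import structures.
From mathcomp Require Import all_boot.
From mathcomp Require Import classical_sets cardinality.

Set Implicit Arguments.
Unset Strict Implicit.
Unset Printing Implicit Defensive.

Local Open Scope classical_set_scope.
Local Open Scope group_scope.

(* [eplus x] is the element written x^+ in the literature. *)
HB.mixin Record isLeftEhresmann S of Semigroup S := {
  eplus : S -> S;
  eplus_mull : forall x : S, eplus x * x = x;
  eplusMplus : forall x y : S, eplus (eplus x * eplus y) = eplus x * eplus y;
  eplusC : forall x y : S, eplus x * eplus y = eplus y * eplus x;
  eplusMr : forall x y : S, eplus (x * y) = eplus (x * eplus y)
}.

#[short(type="leftEhresmannType")]
HB.structure Definition LeftEhresmann :=
  {S of isLeftEhresmann S & Semigroup S}.

HB.mixin Record LeftEhresmann_isLeftHEhresmann S of LeftEhresmann S := {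
  eplus_h : forall x y z : S,
    eplus (x * eplus z * y) = eplus (x * y) * eplus (x * z)
}.

#[short(type="leftHEhresmannType")]
HB.structure Definition LeftHEhresmann :=
  {S of LeftEhresmann_isLeftHEhresmann S & LeftEhresmann S}.

#[short(type="leftHEhresmannMonoidType")]
HB.structure Definition LeftHEhresmannMonoid :=
  {S of LeftHEhresmann S & Monoid S}.

(* Morphisms of (2,1,0)-algebras. *)
Definition ehresmann_morphism (M N : leftHEhresmannMonoidType)
    (f : M -> N) : Prop :=
  [/\ f 1 = 1,
      forall x y, f (x * y) = f x * f y &
      forall x, f (eplus x) = eplus (f x)].

(* The [choiceType] carried by every monoid is no restriction, since any type
   has one classically; [X] is an arbitrary type. *)
Definition is_free_left_h_Ehresmann_monoid (X : Type)
    (F : leftHEhresmannMonoidType) (iota : X -> F) : Prop :=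
  injective iota /\
  forall (M : leftHEhresmannMonoidType) (g : X -> M),
    exists f : F -> M,
      [/\ ehresmann_morphism f,
          forall x, f (iota x) = g x &
          forall f' : F -> M, ehresmann_morphism f' ->
            (forall x, f' (iota x) = g x) -> f' =1 f].

Section IdealHowson.
Variable M : monoidType.
Implicit Types (a b : M) (A I : set M).

Definition right_ideal_gen A : set M := [set a * m | a in A & m in setT].
Definition left_ideal_gen A : set M := [set m * a | a in A & m in setT].

Definition fg_right_ideal I : Prop :=
  exists2 A : set M, finite_set A & I = right_ideal_gen A.
Definition fg_left_ideal I : Prop :=
  exists2 A : set M, finite_set A & I = left_ideal_gen A.

Definition right_ideal_Howson : Prop := forall a b,
  fg_right_ideal (right_ideal_gen [set a] `&` right_ideal_gen [set b]).
Definition left_ideal_Howson : Prop := forall a b,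
  fg_left_ideal (left_ideal_gen [set a] `&` left_ideal_gen [set b]).

End IdealHowson.

(* Main.v *)
(** The free left h-Ehresmann monoid on X is realised as the set of sequences
    A_0 x_1 A_1 ... x_n A_n, where each A_i is a finite prefix-closed set of
    words containing the empty one and x_{i+1} A_{i+1} is contained in A_i.
    Such a sequence stands for e_0 x_1 e_1 ... x_n e_n with e_i the product of
    the w^+ for w in A_i; the h-law makes (x e_i)^+ the product of the (x w)^+,
    so e_{i-1} absorbs it.  In a product, the head B_0 of the right factor is
    added to every A_i as x_{i+1} ... x_n B_0.

    Left ideals: the multiples m a are the sequences that end like a, up to an
    enlargement of the layer that meets the head A_0 of a.  So if m a = n b
    with b at least as long as a, then b splits as (B_0, u ++ s) with s the
    tail of a, and the intersection is generated by (B_0, u) a.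

    Right ideals: if a m = b n with b at least as long as a, one may assume
    that n has length 0.  Let w be the word of b and K the finite set of the d
    such that w d lies in A_0 or B_0 (together with some harmless extra words).
    Removing from each layer of m, n and of the product the words that run to
    the end of w and then continue by a word outside K affects neither a nor b,
    so a m' = b n' with n' taken from a finite set, and b n is a right multiple
    of b n'. *)
From HB Require Import structures.
From mathcomp Require Import all_boot finmap zify.
From mathcomp Require Import boolp classical_sets cardinality.
Require Import Defs.

Set Implicit Arguments.
Unset Strict Implicit.
Unset Printing Implicit Defensive.

Local Open Scope fset_scope.
Local Open Scope group_scope.

(** * Prefix-closed sets of words and the product of layered sequences *)

Section Trees.
Variable X : choiceType.
Implicit Types (x : X) (p q w : seq X) (A B C K : {fset seq X}).

Definition prefix_tree A : bool :=
  `[< [::] \in A /\ forall p q, p ++ q \in A -> p \in A >].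

Lemma prefix_treeP A :
  reflect ([::] \in A /\ forall p q, p ++ q \in A -> p \in A) (prefix_tree A).
Proof. exact: asboolP. Qed.

Definition shift x A : {fset seq X} := [fset x :: p | p in A].

Lemma in_shift x A p :
  (p \in shift x A) = if p is y :: q then (y == x) && (q \in A) else false.
Proof.
apply/imfsetP/idP => [[q /= qA ->]|]; first by rewrite eqxx.
by case: p => // y q /andP[/eqP-> qA]; exists q.
Qed.

Lemma shiftU x A B : shift x (A `|` B) = shift x A `|` shift x B.
Proof. exact: imfsetU. Qed.

Lemma shiftS x A B : A `<=` B -> shift x A `<=` shift x B.
Proof. by move=> AB; rewrite -(fsetUidPr _ _ AB) shiftU fsubsetUl. Qed.

Lemma prefix_tree1 : prefix_tree [fset [::]].
Proof.
apply/prefix_treeP; split=> [|p q]; rewrite !inE //.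
by case: p.
Qed.

Lemma prefix_treeU A B :
  prefix_tree A -> prefix_tree B -> prefix_tree (A `|` B).
Proof.
move=> /prefix_treeP[A0 Ac] /prefix_treeP[_ Bc]; apply/prefix_treeP.
split=> [|p q]; first by rewrite inE A0.
by rewrite !inE => /orP[/Ac->|/Bc->] //; rewrite orbT.
Qed.

Lemma prefix_treeUshift x A B :
  prefix_tree A -> prefix_tree B -> prefix_tree (A `|` shift x B).
Proof.
move=> /prefix_treeP[A0 Ac] /prefix_treeP[B0 Bc]; apply/prefix_treeP.
split=> [|p q]; first by rewrite inE A0.
rewrite !inE => /orP[/Ac->//|]; case: p => [|y p]; first by rewrite A0.
by rewrite /= !in_shift => /andP[-> /Bc->]; rewrite orbT.
Qed.

Fixpoint chain A (s : seq (X * {fset seq X})) : bool :=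
  prefix_tree A &&
  if s is (x, B) :: s' then (shift x B `<=` A) && chain B s' else true.

(* [(A_0, [:: (x_1, A_1); ...; (x_n, A_n)])] encodes [A_0 x_1 A_1 ... x_n A_n];
   the factors are taken in curried form on the left, on which one recurses. *)
Fixpoint mulc A (s : seq (X * {fset seq X}))
    (b : {fset seq X} * seq (X * {fset seq X})) :=
  if s is (x, B) :: s' then
    let c := mulc B s' b in (A `|` shift x c.1, (x, c.1) :: c.2)
  else (A `|` b.1, b.2).

Lemma chain_tree A s : chain A s -> prefix_tree A.
Proof. by case: s => [|[x B] s] /andP[]. Qed.

Lemma mulc_sub A s b : A `<=` (mulc A s b).1.
Proof. by case: s => [|[x B] s]; rewrite fsubsetUl. Qed.

Lemma chain_mulc A s b : chain A s -> chain b.1 b.2 ->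
  chain (mulc A s b).1 (mulc A s b).2.
Proof.
move=> + cb; elim: s A => [|[x B] s IH] A /= /andP[tA].
  by case: b cb => b [|[y D] t] /= /andP[tb] h _; rewrite prefix_treeU //=;
    case/andP: h => yD ->; rewrite fsubsetU ?yD ?orbT.
case/andP=> _ /IH cB; rewrite cB fsubsetUr /= andbT.
exact: prefix_treeUshift tA (chain_tree cB).
Qed.

Lemma mulcU A B s b :
  mulc (A `|` B) s b = (A `|` (mulc B s b).1, (mulc B s b).2).
Proof. by case: s => [|[x C] s] /=; rewrite fsetUA. Qed.

Lemma mulcA A s b c :
  mulc (mulc A s b).1 (mulc A s b).2 c = mulc A s (mulc b.1 b.2 c).
Proof.
elim: s A => [|[x B] s IH] A /=; first by rewrite mulcU.
rewrite IH -fsetUA (fsetUidPr (shift x (mulc B s b).1) _ _) //.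
by rewrite -IH shiftS // mulc_sub.
Qed.

Lemma mul1c b : chain b.1 b.2 -> mulc [fset [::]] [::] b = b.
Proof.
move=> /chain_tree/prefix_treeP[b0 _]; case: b b0 => b t /= b0.
by rewrite (fsetUidPr _ _ _) // fsub1set.
Qed.

Lemma mulc1 A s : chain A s -> mulc A s ([fset [::]], [::]) = (A, s).
Proof.
elim: s A => [|[x B] s IH] A /= /andP[/prefix_treeP[A0 _]].
  by rewrite (fsetUidPl _ _ _) // fsub1set.
by case/andP=> BA /IH ->; rewrite (fsetUidPl _ _ BA).
Qed.

Lemma mulc_fst A s b : (mulc A s b).1 = (mulc A s (b.1, [::])).1.
Proof. by elim: s A => [|[x B] s IH] A //=; rewrite IH. Qed.

(** The layers on the left see only the head of the right factor, whose tail is copied unchanged. *)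
Lemma mulc_snd A s b : (mulc A s b).2 = (mulc A s (b.1, [::])).2 ++ b.2.
Proof.
by elim: s A => [|[x B] s IH] A //=; rewrite IH mulc_fst.
Qed.

(** The h-law in concrete form: each layer receives a shifted copy of the head, and shifting
    commutes with unions. *)
Lemma mulcUr A s B C t :
  (mulc A s (B `|` C, t)).1 = (mulc A s (B, t)).1 `|` (mulc A s (C, [::])).1.
Proof.
elim: s A => [|[x D] s IH] A /=; first by rewrite fsetUACA fsetUid.
by rewrite IH shiftU fsetUACA fsetUid.
Qed.

Lemma size_mulc A s b : size (mulc A s b).2 = (size s + size b.2)%N.
Proof. by elim: s A => [|[x B] s IH] A //=; rewrite IH. Qed.

Lemma mulc_word A s b :
  unzip1 (mulc A s b).2 = unzip1 s ++ unzip1 b.2.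
Proof. by elim: s A => [|[x B] s IH] A //=; rewrite IH. Qed.

(** If nothing new enters the last layer, the chain inclusions prevent any addition further up. *)
Lemma mulc_absorb A s B : chain A s ->
  mulc A s (B, [::]) = (A, s) <-> B `<=` last A (unzip2 s).
Proof.
elim: s A => [|[x C] s IH] A /= /andP[_].
  by move=> _; split=> [[<-]|/fsetUidPl->] //; rewrite fsubsetUr.
case/andP=> CA cC; rewrite -(IH _ cC); split=> [[_ e1 e2]|->].
  by rewrite [LHS]surjective_pairing e1 e2.
by rewrite (fsetUidPl _ _ CA).
Qed.

(** * Truncation of the layers *)

(* [w] is the word [x_{i+1} ... x_n] that remains below the layer of [p]. *)
Definition keep w K p := prefix w p ==> (drop (size w) p \in K).

Lemma keep_cons x w K p : keep (x :: w) K (x :: p) = keep w K p.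
Proof. by rewrite /keep /= eqxx. Qed.

Fixpoint trunc K A (s : seq (X * {fset seq X})) :=
  if s is (x, B) :: s' then
    let c := trunc K B s' in
    ([fset p in A | keep (x :: unzip1 s') K p], (x, c.1) :: c.2)
  else ([fset p in A | keep [::] K p], [::]).

Lemma truncE K A s :
  (trunc K A s).1 = [fset p in A | keep (unzip1 s) K p].
Proof. by case: s => [|[]]. Qed.

Lemma prefix_tree_keep w K A : prefix_tree K -> prefix_tree A ->
  prefix_tree [fset p in A | keep w K p].
Proof.
move=> /prefix_treeP[K0 Kc] /prefix_treeP[A0 Ac]; apply/prefix_treeP; split.
  by rewrite !inE A0 /keep prefixs0; case: (w) => //=.
move=> p q; rewrite !inE => /andP[/Ac-> kp]; apply/implyP=> /prefixP[d def_p].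
by move: kp; rewrite /keep def_p -catA prefix_prefix !drop_size_cat // => /Kc.
Qed.

Lemma chain_trunc K A s : prefix_tree K -> chain A s ->
  chain (trunc K A s).1 (trunc K A s).2.
Proof.
move=> tK; elim: s A => [|[x B] s IH] A /= /andP[tA].
  by rewrite prefix_tree_keep.
case/andP=> BA /IH ->; rewrite prefix_tree_keep //= andbT.
apply/fsubsetP=> -[|y p]; rewrite in_shift // truncE !inE.
case/and3P=> /eqP-> pB kp; rewrite keep_cons kp andbT.
by apply: (fsubsetP BA); rewrite in_shift eqxx.
Qed.

(** The hypothesis says that no word of [A] is cut. It descends to the lower layers by the chain
    inclusions, so only what comes from [b] is truncated. *)
Lemma trunc_mulc K A s b : chain A s ->
    (forall d, unzip1 s ++ unzip1 b.2 ++ d \in A -> d \in K) ->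
  trunc K (mulc A s b).1 (mulc A s b).2 = mulc A s (trunc K b.1 b.2).
Proof.
have sepU A' w B : (forall d, w ++ d \in A' -> d \in K) ->
    [fset p in A' `|` B | keep w K p] = A' `|` [fset p in B | keep w K p].
  move=> A'K; apply/fsetP=> p; rewrite !inE andb_orl; congr orb.
  apply/andb_idr=> pA; apply/implyP=> /prefixP[d def_p].
  by apply: A'K; rewrite def_p drop_size_cat -?def_p.
elim: s A => [|[x B] s IH] A.
  move=> _ /= AK; rewrite (surjective_pairing (trunc _ _ b.2)).
  rewrite (surjective_pairing (trunc _ _ _)) !truncE sepU //; congr pair.
  by case: (b.2) => [|[]].
case/and3P=> _ BA cB AK /=.
have BK d : unzip1 s ++ unzip1 b.2 ++ d \in B -> d \in K.
  by move=> dB; apply: AK; apply: (fsubsetP BA); rewrite in_shift /= eqxx.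
rewrite -IH // sepU; last by move=> d; rewrite mulc_word /= -catA; apply: AK.
congr (_ `|` _, _); apply/fsetP=> p.
rewrite truncE !(in_shift, inE); case: p => // y p; rewrite !inE -andbA.
by case: eqP => // ->; rewrite keep_cons.
Qed.

(** * The left h-Ehresmann monoid of tree chains *)

Record tree_chain := TreeChain {
  tc_val :> {fset seq X} * seq (X * {fset seq X});
  tc_valP : chain tc_val.1 tc_val.2
}.

HB.instance Definition _ := [isSub for tc_val].
HB.instance Definition _ := [Choice of tree_chain by <:].

Definition tc_mul (a b : tree_chain) :=
  TreeChain (chain_mulc (tc_valP a) (tc_valP b)).

Lemma chain1 : chain [fset [::] : seq X] [::].
Proof. by rewrite /= prefix_tree1. Qed.

Definition tc_one := @TreeChain ([fset [::]], [::]) chain1.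

Lemma chain_head A s : chain A s -> chain A [::].
Proof. by move=> /chain_tree tA; rewrite /= tA. Qed.

Definition tc_plus (a : tree_chain) :=
  @TreeChain (a.1, [::]) (chain_head (tc_valP a)).

Lemma tc_mulA : associative tc_mul.
Proof. by move=> a b c; apply/val_inj; rewrite /= mulcA. Qed.

Lemma tc_mul1 : left_id tc_one tc_mul.
Proof. by move=> a; apply/val_inj/mul1c/tc_valP. Qed.

Lemma tc_mulr1 : right_id tc_one tc_mul.
Proof.
by move=> a; apply/val_inj; rewrite /= mulc1 ?tc_valP -?surjective_pairing.
Qed.

HB.instance Definition _ := isMonoid.Build tree_chain tc_mulA tc_mul1 tc_mulr1.

Lemma tc_plus_mull (a : tree_chain) : tc_plus a * a = a.
Proof. by apply/val_inj; rewrite /= fsetUid -surjective_pairing. Qed.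

Lemma tc_plusMplus (a b : tree_chain) :
  tc_plus (tc_plus a * tc_plus b) = tc_plus a * tc_plus b.
Proof. exact/val_inj. Qed.

Lemma tc_plusC (a b : tree_chain) :
  tc_plus a * tc_plus b = tc_plus b * tc_plus a.
Proof. by apply/val_inj; rewrite /= fsetUC. Qed.

Lemma tc_plusMr (a b : tree_chain) : tc_plus (a * b) = tc_plus (a * tc_plus b).
Proof. by apply/val_inj; rewrite /= mulc_fst. Qed.

HB.instance Definition _ := isLeftEhresmann.Build tree_chain
  tc_plus_mull tc_plusMplus tc_plusC tc_plusMr.

Lemma tc_plus_h (a b c : tree_chain) :
  tc_plus (a * tc_plus c * b) = tc_plus (a * b) * tc_plus (a * c).
Proof.
apply/val_inj; rewrite /= mulcA /=; congr pair.
by rewrite mulc_fst /= fsetUC mulcUr -!mulc_fst (mulc_fst _ _ c).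
Qed.

HB.instance Definition _ :=
  LeftEhresmann_isLeftHEhresmann.Build tree_chain tc_plus_h.

(** A generator satisfies [x = x^+ x], so the word [x] has to appear in its head. *)
Lemma chain_gen x : chain [fset [::]; [:: x]] [:: (x, [fset [::]])].
Proof.
have -> : [fset [::]; [:: x]] = [fset [::]] `|` shift x [fset [::]].
  by apply/fsetP=> -[|y [|z p]]; rewrite !(inE, in_shift) // eqseq_cons andbF.
by rewrite /= prefix_treeUshift ?fsubsetUr ?prefix_tree1.
Qed.

Definition tc_gen x : tree_chain := @TreeChain (_, _) (chain_gen x).

End Trees.

(** * Evaluation of tree chains in a left h-Ehresmann monoid *)

Section Eval.
Variables (X : choiceType) (M : leftHEhresmannMonoidType) (h : X -> M).
Implicit Types (x : X) (p q w : seq X) (A B C : {fset seq X}) (L : seq (seq X)).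
Implicit Types (a b : M).

Lemma eplus1 : eplus 1 = 1 :> M.
Proof. by rewrite -[LHS]mulg1 eplus_mull. Qed.

Lemma eplusMid a : eplus a * eplus a = eplus a.
Proof. by rewrite -eplusMplus -eplusMr eplus_mull. Qed.

Definition eval_word w : M := foldr (fun x => mul (h x)) 1 w.

(** Taken on lists to allow induction; by [eq_eval_seq] the value depends only on the set of
    words. *)
Definition eval_seq L : M := foldr (fun w => mul (eplus (eval_word w))) 1 L.

Definition eval_chain A (s : seq (X * {fset seq X})) : M :=
  eval_seq A *
  foldr (fun (xB : X * {fset seq X}) c => h xB.1 * (eval_seq xB.2 * c)) 1 s.

Lemma eplus_eval_seq L : eplus (eval_seq L) = eval_seq L.
Proof.
elim: L => [|w L IH] /=; first exact: eplus1.
by rewrite -/(eval_seq L) -IH eplusMplus.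
Qed.

Lemma eval_seqC L1 L2 : eval_seq L1 * eval_seq L2 = eval_seq L2 * eval_seq L1.
Proof. by rewrite -(eplus_eval_seq L1) -(eplus_eval_seq L2) eplusC. Qed.

Lemma eval_seq_cat L1 L2 : eval_seq (L1 ++ L2) = eval_seq L1 * eval_seq L2.
Proof. by elim: L1 => [|w L IH] /=; rewrite ?mul1g // IH mulgA. Qed.

Lemma eval_seq_mem w L :
  w \in L -> eplus (eval_word w) * eval_seq L = eval_seq L.
Proof.
elim: L => // v L IH; rewrite inE => /predU1P[<-|/IH wL] /=.
  by rewrite mulgA eplusMid.
by rewrite mulgA eplusC -mulgA wL.
Qed.

Lemma eval_seq_sub L1 L2 :
  {subset L1 <= L2} -> eval_seq L1 * eval_seq L2 = eval_seq L2.
Proof.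
elim: L1 => [|w L IH] sL /=; first by rewrite mul1g.
rewrite -mulgA IH => [|v vL]; last by rewrite sL // inE vL orbT.
by rewrite eval_seq_mem // sL // mem_head.
Qed.

Lemma eq_eval_seq L1 L2 : L1 =i L2 -> eval_seq L1 = eval_seq L2.
Proof.
move=> eL; rewrite -(@eval_seq_sub L2 L1) => [|w]; last by rewrite eL.
by rewrite eval_seqC eval_seq_sub // => w; rewrite eL.
Qed.

Lemma eval_fsetU A B : eval_seq (A `|` B) = eval_seq A * eval_seq B.
Proof.
by rewrite -eval_seq_cat; apply: eq_eval_seq => w; rewrite inE mem_cat.
Qed.

Lemma eval_fsubset A B : A `<=` B -> eval_seq B * eval_seq A = eval_seq B.
Proof. by move=> /fsubsetP AB; rewrite eval_seqC eval_seq_sub. Qed.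

(* For empty [A] the left-hand side is [eplus (h x)] and the right-hand side
   is [1]. *)
Lemma eplus_shift x A :
  [::] \in A -> eplus (h x * eval_seq A) = eval_seq (shift x A).
Proof.
move=> A0; rewrite (@eq_eval_seq (shift x A) [seq x :: p | p <- A]); last first.
  move=> p; rewrite in_shift; apply/idP/mapP => [|[q qA ->]].
    by case: p => // y p /andP[/eqP-> pA]; exists p.
  by rewrite eqxx.
move: A0; rewrite -[_ \in A]/(_ \in enum_fset A).
case: (enum_fset A) => // w L _.
(* The base case is [(xy)^+ = (xy^+)^+]; the h-law then splits off one factor at a time. *)
elim: L w => [|v L IH] w /=; first by rewrite !mulg1 -eplusMr.
by rewrite mulgA eplus_h eplusC; congr (_ * _); apply: IH.
Qed.

Lemma eval_chain_cons A x B s :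
  eval_chain A ((x, B) :: s) = eval_seq A * (h x * eval_chain B s).
Proof. by []. Qed.

(** The projection coming from the tail is the value of [shift x B], which [A] absorbs because it
    contains that set. *)
Lemma eplus_eval_chain A s : chain A s -> eplus (eval_chain A s) = eval_seq A.
Proof.
elim: s A => [|[x B] s IH] A; first by rewrite /eval_chain mulg1 eplus_eval_seq.
case/and3P=> _ BA cB; rewrite eval_chain_cons.
have /prefix_treeP[B0 _] := chain_tree cB.
rewrite eplusMr (eplusMr (h x)) IH // eplus_shift //.
by rewrite eval_fsubset // eplus_eval_seq.
Qed.

(** With [y] the value of the chain, [(xy)^+] is the value of [shift x A], and [(xy)^+ xy = xy].
    Hence the words that [mulc] adds to a layer do not change the value. *)
Lemma eval_chain_shift x A s : chain A s ->
  eval_seq (shift x A) * (h x * eval_chain A s) = h x * eval_chain A s.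
Proof.
move=> cA; have /prefix_treeP[A0 _] := chain_tree cA.
by rewrite -eplus_shift // -(eplus_eval_chain cA) -eplusMr eplus_mull.
Qed.

Lemma eval_mulc A s (b : {fset seq X} * seq (X * {fset seq X})) :
    chain A s -> chain b.1 b.2 ->
  eval_chain (mulc A s b).1 (mulc A s b).2 =
    eval_chain A s * eval_chain b.1 b.2.
Proof.
move=> + cb; elim: s A => [|[x B] s IH] A.
  by rewrite /eval_chain /= eval_fsetU mulg1 mulgA.
case/and3P=> _ _ cB; rewrite /= eval_chain_cons eval_fsetU -mulgA.
by rewrite eval_chain_shift ?chain_mulc // IH // eval_chain_cons !mulgA.
Qed.

Definition tc_eval (c : tree_chain X) : M := eval_chain c.1 c.2.

Lemma eval_fset0 : eval_seq [fset [::]] = 1.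
Proof.
rewrite (@eq_eval_seq _ [:: [::]]) /= ?eplus1 ?mulg1 // => w.
by rewrite !inE.
Qed.

Lemma tc_eval_morphism : ehresmann_morphism tc_eval.
Proof.
split=> [|a b|a].
- by rewrite /tc_eval /eval_chain eval_fset0 mulg1.
- exact: eval_mulc (tc_valP a) (tc_valP b).
- by rewrite eplus_eval_chain ?tc_valP // /tc_eval /eval_chain /= mulg1.
Qed.

Lemma tc_eval_gen x : tc_eval (tc_gen x) = h x.
Proof.
rewrite /tc_eval /eval_chain /= eval_fset0 !mulg1.
rewrite (@eq_eval_seq _ [:: [::]; [:: x]]) /= => [|w]; last by rewrite !inE.
by rewrite eplus1 mul1g !mulg1 eplus_mull.
Qed.

End Eval.

Lemma eval_morph (X : choiceType) (M N : leftHEhresmannMonoidType)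
    (f : M -> N) (h : X -> M) : ehresmann_morphism f ->
  f \o tc_eval h =1 tc_eval (f \o h).
Proof.
case=> f1 fM fP [[A s] cA]; rewrite /tc_eval /= {cA}.
have fw w : f (eval_word h w) = eval_word (f \o h) w.
  by elim: w => //= x w <-; rewrite fM.
have fS L : f (eval_seq h L) = eval_seq (f \o h) L.
  by elim: L => //= w L <-; rewrite fM fP fw.
rewrite /eval_chain fM fS; congr (_ * _).
by elim: s => //= -[x B] s <-; rewrite !fM fS.
Qed.

(** * Tree chains as products of generators and projections *)

Section TreeChainGenerators.
Variable X : choiceType.
Implicit Types (x : X) (p q w : seq X) (A B C : {fset seq X}) (L : seq (seq X)).
Implicit Types (a b c m n : tree_chain X).

Lemma tc_valM a b : a * b = mulc a.1 a.2 b :> _ * _.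
Proof. by []. Qed.

Lemma nil_in_tc c : [::] \in c.1.
Proof. by have /chain_tree/prefix_treeP[] := tc_valP c. Qed.

Lemma eval_word_gen w p : (p \in (eval_word (@tc_gen X) w).1) = prefix p w.
Proof.
elim: w p => [|x w IH] [|y p] /=; rewrite ?nil_in_tc ?inE //=.
rewrite in_shift !inE eqseq_cons -andb_orr IH.
by case: p => [|z p]; rewrite ?prefix0s.
Qed.

(** A prefix-closed set is the union of the prefix sets of its members, and these represent the
    [w^+]. *)
Lemma eval_seq_gen A : prefix_tree A ->
  eval_seq (@tc_gen X) A = (A, [::]) :> _ * _.
Proof.
move=> /prefix_treeP[A0 Ac].
have [e2 e1] : (eval_seq (@tc_gen X) A).2 = [::] /\ forall p,
    (p \in (eval_seq (@tc_gen X) A).1) = (p == [::]) || has (prefix p) A.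
  elim: (enum_fset A) => /= [|w L [-> IH]].
    by split=> // p; rewrite !inE orbF.
  by split=> // p; rewrite !inE IH eval_word_gen orbCA.
rewrite [LHS]surjective_pairing e2; congr pair; apply/fsetP=> p; rewrite e1.
apply/orP/idP => [[/eqP->//|/hasP[w wA /prefixP[q wE]]]|pA].
  by apply: (Ac p q); rewrite -wE.
by right; apply/hasP; exists p; rewrite ?prefix_refl.
Qed.

Lemma eval_chain_gen A s :
  chain A s -> eval_chain (@tc_gen X) A s = (A, s) :> _ * _.
Proof.
elim: s A => [|[x B] s IH] A cA.
  by rewrite /eval_chain [foldr _ _ _]/= mulg1 eval_seq_gen // (chain_tree cA).
have /and3P[tA BA cB] := cA.
rewrite eval_chain_cons tc_valM (tc_valM (tc_gen x)).
rewrite eval_seq_gen // IH //=.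
have /prefix_treeP[A0 _] := tA; have /prefix_treeP[B0 _] := chain_tree cB.
have -> : [fset [::]] `|` B = B by rewrite (fsetUidPr _ _ _) // fsub1set.
rewrite (fsetUidPl _ _ _) // !fsubUset BA !fsub1set A0 /= andbT.
by apply: (fsubsetP BA); rewrite in_shift eqxx.
Qed.

Lemma tc_eval_id : tc_eval (@tc_gen X) =1 id.
Proof.
move=> c; apply/val_inj; rewrite [RHS]surjective_pairing.
exact: eval_chain_gen (tc_valP c).
Qed.

End TreeChainGenerators.

(** * Transport of the Howson properties along an isomorphism *)

Section Transfer.
Variables (M N : monoidType) (f : M -> N) (g : N -> M).
Hypotheses (fM : forall x y, f (x * y) = f x * f y).
Hypotheses (fK : cancel f g) (gK : cancel g f).

Lemma preimage_singleton a : (f @^-1` [set f a] = [set a])%classic.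
Proof. by apply/seteqP; split=> c /= => [/(can_inj fK)|->]. Qed.

Lemma preimage_right_ideal A :
  (f @^-1` right_ideal_gen A = right_ideal_gen (f @^-1` A))%classic.
Proof.
apply/seteqP; split=> c /=.
  move=> [a Aa [m _ e]]; exists (g a); first by rewrite /= gK.
  by exists (g m); rewrite // -[RHS]fK -e -(gK a) -(gK m) -fM !fK.
by move=> [a Aa [m _ <-]]; exists (f a) => //; exists (f m); rewrite ?fM.
Qed.

Lemma preimage_left_ideal A :
  (f @^-1` left_ideal_gen A = left_ideal_gen (f @^-1` A))%classic.
Proof.
apply/seteqP; split=> c /=.
  move=> [a Aa [m _ e]]; exists (g a); first by rewrite /= gK.
  by exists (g m); rewrite // -[RHS]fK -e -(gK a) -(gK m) -fM !fK.
by move=> [a Aa [m _ <-]]; exists (f a) => //; exists (f m); rewrite ?fM.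
Qed.

Lemma right_ideal_Howson_iso : right_ideal_Howson N -> right_ideal_Howson M.
Proof.
move=> HN a b; have [A finA e] := HN (f a) (f b); exists (f @^-1` A)%classic.
  by apply: finite_preimage => // x y _ _; apply: can_inj fK _ _.
by rewrite -!preimage_singleton -!preimage_right_ideal -preimage_setI e.
Qed.

Lemma left_ideal_Howson_iso : left_ideal_Howson N -> left_ideal_Howson M.
Proof.
move=> HN a b; have [A finA e] := HN (f a) (f b); exists (f @^-1` A)%classic.
  by apply: finite_preimage => // x y _ _; apply: can_inj fK _ _.
by rewrite -!preimage_singleton -!preimage_left_ideal -preimage_setI e.
Qed.

End Transfer.

(** * Finite generation from a finite set of common multiples *)

Lemma fg_right_idealI (M : monoidType) (a b : M) (G : set M) : finite_set G ->
    (forall c, G c -> (exists m, c = a * m) /\ exists n, c = b * n) ->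
    (forall m n, a * m = b * n -> exists2 c, G c & exists k, a * m = c * k) ->
  fg_right_ideal (right_ideal_gen [set a] `&` right_ideal_gen [set b])%classic.
Proof.
move=> finG Gab abG; exists G => //; apply/seteqP; split=> c.
  case=> -[_ -> [m _ <-]] [_ -> [n _ /esym/abG[d Gd [k ->]]]].
  by exists d => //; exists k.
case=> d /Gab[[m dm] [n dn]] [k _ <-]; split.
  by exists a => //; exists (m * k); rewrite // dm mulgA.
by exists b => //; exists (n * k); rewrite // dn mulgA.
Qed.

Lemma fg_left_idealI (M : monoidType) (a b : M) (G : set M) : finite_set G ->
    (forall c, G c -> (exists m, c = m * a) /\ exists n, c = n * b) ->
    (forall m n, m * a = n * b -> exists2 c, G c & exists k, m * a = k * c) ->
  fg_left_ideal (left_ideal_gen [set a] `&` left_ideal_gen [set b])%classic.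
Proof.
move=> finG Gab abG; exists G => //; apply/seteqP; split=> c.
  case=> -[_ -> [m _ <-]] [_ -> [n _ /esym/abG[d Gd [k ->]]]].
  by exists d => //; exists k.
case=> d /Gab[[m dm] [n dn]] [k _ <-]; split.
  by exists a => //; exists (k * m); rewrite // dm mulgA.
by exists b => //; exists (k * n); rewrite // dn mulgA.
Qed.

(** * Intersections of principal left ideals *)

Section Howson.
Variable X : choiceType.
Implicit Types (a b c m n u : tree_chain X) (A B K : {fset seq X}).

Lemma chain_catl A (s t : seq (X * {fset seq X})) :
  chain A (s ++ t) -> chain A s.
Proof.
elim: s A => [|[x B] s IH] A /=; first by move/chain_tree->.
by case/and3P=> -> -> /IH.
Qed.

Lemma tc_mul_fst a b : (a * b).1 = (a * eplus b).1.
Proof. exact: mulc_fst. Qed.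

Lemma tc_mul_snd a b : (a * b).2 = (a * eplus b).2 ++ b.2.
Proof. exact: mulc_snd. Qed.

Lemma tc_eqP a b : a.1 = b.1 -> a.2 = b.2 -> a = b.
Proof.
move=> e1 e2; apply/val_inj.
by rewrite [LHS]surjective_pairing [RHS]surjective_pairing; congr pair.
Qed.

(** Left multiplication leaves the tail of a factor unchanged, so [a.2] and [b.2] are suffixes of
    the same sequence. *)
Lemma left_factor a b m n : (size a.2 <= size b.2)%N -> m * a = n * b ->
  exists2 u : tree_chain X, u.1 = b.1 & b.2 = u.2 ++ a.2.
Proof.
move=> ab e; pose s := take (size b.2 - size a.2) b.2.
have cs : chain b.1 s.
  apply: (@chain_catl _ _ (drop (size b.2 - size a.2) b.2)).
  by rewrite cat_take_drop tc_valP.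
exists (@TreeChain _ (b.1, s) cs) => //=.
rewrite -{1}(cat_take_drop (size b.2 - size a.2) b.2); congr cat.
have e2 : (m * eplus a).2 ++ a.2 = (n * eplus b).2 ++ b.2.
  by rewrite -!tc_mul_snd e.
have := congr1 size e2; rewrite !size_cat => es.
have := congr1 (drop (size (m * eplus a).2)) e2.
rewrite drop_size_cat // => a2; rewrite [RHS]a2 drop_cat ltnNge.
have -> : (size (n * eplus b)%g.2 <= size (m * eplus a)%g.2)%N by lia.
by congr drop; lia.
Qed.

Lemma mul_left_factor a b m n u :
    u.1 = b.1 -> b.2 = u.2 ++ a.2 -> m * a = n * b -> m * eplus a = n * u.
Proof.
move=> u1 b2 e; apply: tc_eqP.
  rewrite -tc_mul_fst e (tc_mul_fst n b) (tc_mul_fst n u).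
  by congr (n * _).1; apply: tc_eqP.
have: (m * a).2 = (n * b).2 by rewrite e.
rewrite (tc_mul_snd m a) (tc_mul_snd n b) b2 catA => /eqP.
rewrite eqseq_cat; last first.
  have := congr1 (fun c => size c.2) e.
  by rewrite size_cat !size_mulc /= b2 size_cat; lia.
case/andP=> /eqP-> _; rewrite (tc_mul_snd n u); congr ((n * _).2 ++ _).
exact: tc_eqP.
Qed.

Lemma tc_left_Howson : left_ideal_Howson (tree_chain X).
Proof.
move=> a b; wlog ab : a b / (size a.2 <= size b.2)%N.
  move=> H; have /orP[/H//|/H] := leq_total (size a.2) (size b.2).
  by rewrite setIC.
have [[m0 [n0 e0]]|none] := pselect (exists m n, m * a = n * b); last first.
  apply: (@fg_left_idealI _ _ _ set0) => // m n e.
  by case: none; exists m, n.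
have [u u1 b2] := left_factor ab e0.
have factor := mul_left_factor u1 b2.
apply: (@fg_left_idealI _ _ _ [set u * a]%classic) => [|_ ->|m n e].
- exact: finite_set1.
- split; first by exists u.
  (* If [u] has length 0, then [b] has the tail of [a], and [u a = a^+ b]. *)
  have [u20|u2N] := eqVneq u.2 [::].
    exists (eplus a); apply: tc_eqP; first by rewrite /= u20 u1 fsetUC.
    by rewrite /= u20 b2 u20.
  (* Otherwise [u a = b], because the last layer of [u] already contains the head of [a]. *)
  exists 1; rewrite mul1g; suff ua : u * eplus a = u.
    by apply: tc_eqP; [rewrite tc_mul_fst ua|rewrite tc_mul_snd ua].
  apply/val_inj; rewrite [RHS]surjective_pairing.
  apply/(mulc_absorb a.1 (tc_valP u)).
  (* The product [m0 a^+ = n0 u] has the same last layer as [u], and multiplying it by [a^+] on the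
     right fixes it. *)
  have : a.1 `<=` last (m0 * eplus a).1 (unzip2 (m0 * eplus a).2).
    apply/(mulc_absorb a.1 (tc_valP _)); rewrite -surjective_pairing.
    by rewrite -[LHS]/(tc_val (m0 * eplus a * eplus a)) -mulgA eplusMid.
  rewrite (factor m0 n0 e0) tc_mul_snd /unzip2 map_cat last_cat.
  by case: (u.2) u2N.
- exists (u * a) => //; exists n.
  by rewrite mulgA -(factor m n e) -mulgA eplus_mull.
Qed.

(** * Intersections of principal right ideals *)

Lemma finite_tc_projections K :
  finite_set [set c : tree_chain X | (c.1 `<=` K)%fset /\ c.2 = [::]]%classic.
Proof.
(* Sets that are not prefix-closed are sent to the default [1], which is harmless for an upper
   bound. *)
apply: (@sub_finite_set _ _
  ((fun A => insubd (1 : tree_chain X) (A, [::])) @`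
     [set` fpowerset K])%classic).
  move=> c [cK c2]; exists c.1; first by rewrite /= fpowersetE.
  apply: val_inj; rewrite insubdK -?c2 -?surjective_pairing //.
  exact: tc_valP.
exact/finite_image/finite_fset.
Qed.

(** Both products are cut after as many letters as [b] has: on the right this turns [n] into [n^+],
    on the left it shortens [m]. *)
Lemma right_factor a b m n : (size a.2 <= size b.2)%N -> a * m = b * n ->
  exists2 m' : tree_chain X, a * m' = b * eplus n &
    (size a.2 + size m'.2 = size b.2)%N.
Proof.
move=> ab e; pose k := (size b.2 - size a.2)%N.
have cm : chain m.1 (take k m.2).
  by apply: (@chain_catl _ _ (drop k m.2)); rewrite cat_take_drop tc_valP.
have e2 : (a * eplus m).2 ++ m.2 = (b * eplus n).2 ++ n.2.
  by rewrite -!tc_mul_snd e.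
have sa : size (a * eplus m)%g.2 = size a.2 by rewrite size_mulc addn0.
have sb : size (b * eplus n)%g.2 = size b.2 by rewrite size_mulc addn0.
have := congr1 size e2; rewrite !size_cat sa sb => es.
exists (@TreeChain _ (m.1, take k m.2) cm); last first.
  by rewrite /= size_take; case: ltnP; lia.
apply: tc_eqP; first by rewrite -tc_mul_fst -e (tc_mul_fst a) (tc_mul_fst a m).
rewrite tc_mul_snd [RHS](_ : _ = take (size b.2) ((a * eplus m).2 ++ m.2)).
  by rewrite take_cat sa ltnNge ab.
by rewrite e2 -sb take_size_cat.
Qed.

Lemma tc_right_Howson : right_ideal_Howson (tree_chain X).
Proof.
move=> a b; wlog ab : a b / (size a.2 <= size b.2)%N.
  move=> H; have /orP[/H//|/H] := leq_total (size a.2) (size b.2).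
  by rewrite setIC.
(* The dropped letters are not compared with the word of [b]. The extra words this admits leave [K]
   finite and prefix-closed, and short words yield only the empty word. *)
pose K := [fset drop (size b.2) p | p in a.1 `|` b.1].
have tK : prefix_tree K.
  have /prefix_treeP[A0 Ac] :=
    prefix_treeU (chain_tree (tc_valP a)) (chain_tree (tc_valP b)).
  apply/prefix_treeP; split; first by apply/imfsetP; exists [::].
  move=> p q /imfsetP[/= r rA pq]; have [rb|br] := leqP (size r) (size b.2).
    move: pq; rewrite drop_oversize //; case: p => // _.
    by apply/imfsetP; exists [::].
  apply/imfsetP; exists (take (size b.2) r ++ p) => /=; last first.
    by rewrite drop_size_cat // size_takel // ltnW.
  by apply: (Ac _ q); rewrite -catA pq cat_take_drop.
have inK w d : size w = size b.2 -> w ++ d \in a.1 `|` b.1 -> d \in K.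
  by move=> sw wdA; apply/imfsetP; exists (w ++ d); rewrite //= drop_size_cat.
pose G := ([set b * c | c in
    [set c : tree_chain X | (c.1 `<=` K)%fset /\ c.2 = [::]]] `&`
  [set c | exists m, c = a * m])%classic.
apply: (@fg_right_idealI _ _ _ G) => [|c [[d _ <-] am]|m n e].
- exact/finite_setIl/finite_image/finite_tc_projections.
- by split=> //; exists d.
have [m' e' sm'] := right_factor ab e.
pose t := TreeChain (chain_trunc tK (tc_valP m')).
pose d := TreeChain (chain_trunc tK (tc_valP (eplus n))).
have ad : a * t = b * d.
  have aK p : unzip1 a.2 ++ unzip1 m'.2 ++ p \in a.1 -> p \in K.
    move=> pa; apply: (inK (unzip1 a.2 ++ unzip1 m'.2)).
      by rewrite size_cat !size_map.
    by rewrite inE -catA pa.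
  have bK p : unzip1 b.2 ++ [::] ++ p \in b.1 -> p \in K.
    by move=> pb; apply: (inK (unzip1 b.2)); rewrite ?size_map // inE pb orbT.
  (* By [trunc_mulc] the two sides are truncations of [a m'] and [b n^+], which are equal. *)
  apply: val_inj; rewrite -[LHS](trunc_mulc (tc_valP a) aK).
  rewrite -[RHS](@trunc_mulc _ K _ _ (eplus n) (tc_valP b) bK).
  by rewrite -tc_valM e'.
exists (b * d); first (split; last by exists t).
  exists d => //; split=> //=; apply/fsubsetP=> p /=.
  by rewrite !inE /keep prefix0s drop0 => /andP[].
(* The head of [d] lies in that of [n], hence [d n = n] and [b n = (b d) n]. *)
exists n; rewrite e -mulgA; congr (b * _); apply: tc_eqP => //=.
apply/esym/fsetUidPr/fsubsetP=> p; by rewrite !inE => /andP[].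
Qed.

End Howson.

(** * Identification of the free monoid with the tree chains *)

Theorem proposition5p6 (X : Type) (F : leftHEhresmannMonoidType) (iota : X -> F)
    (free_F : is_free_left_h_Ehresmann_monoid iota) :
  left_ideal_Howson F /\ right_ideal_Howson F.
Proof.
case: free_F => _ univ.
pose T := tree_chain {classic X}.
have [f [f_morph f_iota _]] := univ T (@tc_gen {classic X}).
pose g : T -> F := tc_eval (iota : {classic X} -> F).
have g_morph : ehresmann_morphism g := tc_eval_morphism _.
have fK : cancel f g.
  (* Both [g \o f] and the identity are endomorphisms of [F] extending [iota], so uniqueness
     identifies them. *)
  have [id' [_ _ id'_uniq]] := univ F iota.
  have id_eq : id =1 id' by apply: id'_uniq.
  suff gf_eq : g \o f =1 id' by move=> c; rewrite [RHS]id_eq -gf_eq.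
  apply: id'_uniq => [|x]; last by rewrite /= f_iota; apply: tc_eval_gen.
  case: f_morph g_morph => f1 fM fP [g1 gM gP].
  by split=> [|x y|x] /=; rewrite ?f1 ?fM ?fP ?g1 ?gM ?gP.
have gK : cancel g f.
  (* Morphisms commute with evaluation, so [f \o g] evaluates a tree chain at the generators
     [tc_gen], which gives back the chain. *)
  move=> c; rewrite -[LHS]/((f \o g) c) (eval_morph _ f_morph).
  have -> : f \o (iota : {classic X} -> F) = @tc_gen {classic X}.
    exact/funext.
  exact: tc_eval_id.
have [_ fM _] := f_morph; split.
- exact: left_ideal_Howson_iso fM fK gK (@tc_left_Howson _).
- exact: right_ideal_Howson_iso fM fK gK (@tc_right_Howson _).
Qed.
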